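(* Let $N^\pm=\{(\lambda,t)\in N:\lambda\in C^\pm\}$. Then $\mathrm{MAX}^2\cap N^\pm=\emptyset$ (for both signs).
   Context: Timelike normal extremals in the sub-Lorentzian Engel group ($\mathbb{R}^4$, coordinates $q=(x_1,x_2,y,z)$), on the level $H=-1/2$ with $h_1=\cosh\theta$, $h_2=\sinh\theta$, $h_3=c$, $h_4=\alpha$, satisfy $$\dot x_1=-\cosh\theta,\ \dot x_2=\sinh\theta,\ \dot y=\tfrac12(x_2\cosh\theta+x_1\sinh\theta),\ \dot z=\tfrac{x_1^2+x_2^2}{2}\sinh\theta,\ \dot\theta=-c,\ \dot c=-\alpha\cosh\theta,\ \dot\alpha=0,$$ with $q(0)=0$. Let $C=\{\lambda=(\theta,c,\alpha)\in\mathbb{R}^3\}$, $C^+=\{\alpha>0\}$, $C^-=\{\alpha<0\}$. For $\lambda\in C$ let $t_{\mathrm{supr}}(\lambda)\in(0,+\infty]$ be the explosion (maximal forward existence) time of the solution with initial values $\lambda$, $q(0)=0$; let $N=\{(\lambda,t): \lambda\in C,\ 0<t<t_{\mathrm{supr}}(\lambda)\}$ and $\mathrm{Exp}:N\to\mathbb{R}^4$, $\mathrm{Exp}(\lambda,t)=q(t)$. Let $e^{t\vec H_v}$ be the flow of the vertical system $\dot\theta=-c$, $\dot c=-\alpha\cosh\theta$, $\dot\alpha=0$ on $C$, and $\varepsilon^2(\theta,c,\alpha)=(\theta,-c,\alpha)$. For $(\lambda,t)\in N$ put $\lambda^2=\varepsilon^2(e^{t\vec H_v}(\lambda))$. The Maxwell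 set is $$\mathrm{MAX}^2=\{(\lambda,t)\in N:\ \lambda^2\ne\lambda,\ \mathrm{Exp}(\lambda^2,t)=\mathrm{Exp}(\lambda,t)\}.$$ *)

(* Defs.v *)
From Stdlib Require Import Reals ClassicalEpsilon.
From Coquelicot Require Import Coquelicot.
Open Scope R_scope.

(** Vertical coordinates on the level [H = -1/2]:
    [h1 = cosh theta], [h2 = sinh theta], [h3 = c], [h4 = alpha]. *)
Record covector := Covector { theta : R; c : R; alpha : R }.
Record point := Point { x1 : R; x2 : R; y : R; z : R }.

Definition origin : point := Point 0 0 0 0.

Definition vertical_on (a b : R) (l : R -> covector) : Prop :=
  forall s, a < s < b ->
    is_derive (fun u => theta (l u)) s (- c (l s)) /\
    is_derive (fun u => c (l u)) s (- alpha (l s) * cosh (theta (l s))) /\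
    is_derive (fun u => alpha (l u)) s 0.

Definition horizontal_on (a b : R) (l : R -> covector) (q : R -> point) : Prop :=
  forall s, a < s < b ->
    is_derive (fun u => x1 (q u)) s (- cosh (theta (l s))) /\
    is_derive (fun u => x2 (q u)) s (sinh (theta (l s))) /\
    is_derive (fun u => y (q u)) s
      (/ 2 * (x2 (q s) * cosh (theta (l s)) + x1 (q s) * sinh (theta (l s)))) /\
    is_derive (fun u => z (q u)) s
      ((x1 (q s) ^ 2 + x2 (q s) ^ 2) / 2 * sinh (theta (l s))).

(** Solutions live on an open interval [(a, b)] containing [0]; curves are total
    functions whose values outside the interval are irrelevant. *)
Definition extremal (lam : covector) (a b : R)
    (l : R -> covector) (q : R -> point) : Prop :=
  a < 0 < b /\ l 0 = lam /\ q 0 = origin /\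
  vertical_on a b l /\ horizontal_on a b l q.

(** By uniqueness of solutions, the maximal forward existence time is the
    supremum of the right ends of the intervals carrying a solution. *)
Definition t_supr (lam : covector) : Rbar :=
  Lub_Rbar (fun b => exists a l q, extremal lam a b l q).

Definition N (lam : covector) (t : R) : Prop :=
  0 < t /\ Rbar_lt t (t_supr lam).

(** Value at time [t] of the solution; unspecified if no solution reaches [t]. *)
Definition Exp (lam : covector) (t : R) : point :=
  epsilon (inhabits origin) (fun p =>
    exists a b l q, extremal lam a b l q /\ a < t < b /\ q t = p).

(** The flow of the vertical system alone, with the same convention. *)
Definition flow_v (t : R) (lam : covector) : covector :=
  epsilon (inhabits lam) (fun mu =>
    exists a b l, a < 0 < b /\ l 0 = lam /\ vertical_on a b l /\
                  a < t < b /\ l t = mu).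

Definition eps2 (lam : covector) : covector :=
  Covector (theta lam) (- c lam) (alpha lam).

Definition lambda2 (lam : covector) (t : R) : covector :=
  eps2 (flow_v t lam).

(** Time reversal [s |-> t - s] of the vertical system shows that
    [N (lambda2 lam t) t] holds whenever [N lam t] does, so both values of [Exp]
    are genuine. *)
Definition MAX2 (lam : covector) (t : R) : Prop :=
  N lam t /\ lambda2 lam t <> lam /\ Exp (lambda2 lam t) t = Exp lam t.

Definition Cplus (lam : covector) : Prop := 0 < alpha lam.
Definition Cminus (lam : covector) : Prop := alpha lam < 0.

Definition Nplus (lam : covector) (t : R) : Prop := N lam t /\ Cplus lam.
Definition Nminus (lam : covector) (t : R) : Prop := N lam t /\ Cminus lam.

(* Main.v *)
Require Import Defs.
From Stdlib Require Import Reals.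
From Coquelicot Require Import Coquelicot.
From Stdlib Require Import Lra Classical ClassicalEpsilon.
Open Scope R_scope.

(** Along an extremal with [alpha <> 0], both [alpha] and the energy
    [E = c^2/2 - alpha sinh theta] are conserved, and [c] is strictly monotone,
    so everything is a function of [c]: with [T(c) = tanh theta] and [A' = T],
    one gets [alpha x1 = c - c0], [alpha x2 = A(c0) - A(c)], and [2 alpha^2 y]
    is minus the error of the trapezoidal rule for twice the integral of [A]
    from [c0] to [c].  Since [T] is a monotone function of [alpha c^2], this
    error has a sign governed by the midpoint of [c0] and [c]: [y(t)] has the
    sign of [c(0) + c(t)].  For the reflected extremal, [c] runs from [-c(t)] to
    [-c(0)], so its [y] has the opposite sign.  A Maxwell point therefore has
    [c(t) = -c(0)], and then conservation of energy gives
    [theta(t) = theta(0)], that is [lambda^2 = lambda]. *)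

(** * Calculus and hyperbolic identities *)

Lemma antiderivative_exists (f : R -> R) :
  (forall x, ex_derive f x) -> exists F, forall x, is_derive F x (f x).
Proof.
intros Hf.
assert (Hc : forall x, continuous f x).
{ intros x; apply (ex_derive_continuous (V := R_NormedModule)); apply Hf. }
exists (fun x => RInt f 0 x); intros x.
apply (is_derive_RInt f (fun u => RInt f 0 u) 0 x); [ | apply Hc].
apply filter_forall; intros u.
apply (RInt_correct (V := R_CompleteNormedModule)).
apply (ex_RInt_continuous (V := R_CompleteNormedModule)); auto.
Qed.

Ltac rewrite_derivatives :=
  repeat match goal with |- context [Derive ?g ?x] =>
    erewrite (is_derive_unique g x) by
      (eassumption ||
       match goal with H : forall u, is_derive _ u _ |- _ => apply H end)
  end.

Lemma MVT_lt (f df : R -> R) (u v : R) :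
  u < v -> (forall s, u <= s <= v -> is_derive f s (df s)) ->
  exists s, u < s < v /\ f v - f u = df s * (v - u).
Proof.
intros Huv Hd.
destruct (MVT_cor2 f df u v Huv) as [s [E Hs]].
{ intros s Hs; apply is_derive_Reals; auto. }
exists s; auto.
Qed.

Lemma derive_zero_constant (f : R -> R) (a b u v : R) :
  (forall s, a < s < b -> is_derive f s 0) ->
  a < u < b -> a < v < b -> f u = f v.
Proof.
intros Hd.
assert (H : forall u v, u < v -> a < u < b -> a < v < b -> f u = f v).
{ clear u v; intros u v Huv Hu Hv.
  destruct (MVT_lt f (fun _ => 0) u v Huv) as [s [_ E]]; [ | lra].
  intros s Hs; apply Hd; lra. }
intros Hu Hv; destruct (Rtotal_order u v) as [L | [-> | L]]; auto.
symmetry; auto.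
Qed.

Lemma cosh_sqr (x : R) : cosh x ^ 2 = 1 + sinh x ^ 2.
Proof.
assert (H : exp x * exp (- x) = 1) by (rewrite <- exp_plus, Rplus_opp_r; apply exp_0).
unfold cosh, sinh; nra.
Qed.

Lemma cosh_pos (x : R) : 0 < cosh x.
Proof. unfold cosh; generalize (exp_pos x), (exp_pos (- x)); lra. Qed.

Lemma sinh_inj (u v : R) : sinh u = sinh v -> u = v.
Proof. intros H; rewrite <- (arcsinh_sinh u), H; apply arcsinh_sinh. Qed.

Lemma cosh_sinh (x : R) : cosh x = sqrt (1 + sinh x ^ 2).
Proof.
rewrite <- cosh_sqr; symmetry; apply sqrt_pow2; apply Rlt_le, cosh_pos.
Qed.

Definition tanh_of_sinh (x : R) : R := x / sqrt (1 + x ^ 2).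

Lemma tanh_of_sinh_lt (x v : R) : x < v -> tanh_of_sinh x < tanh_of_sinh v.
Proof.
intros H; unfold tanh_of_sinh.
assert (Ha : 0 < sqrt (1 + x ^ 2)) by (apply sqrt_lt_R0; nra).
assert (Hb : 0 < sqrt (1 + v ^ 2)) by (apply sqrt_lt_R0; nra).
assert (Ea := pow2_sqrt (1 + x ^ 2) ltac:(nra)).
assert (Eb := pow2_sqrt (1 + v ^ 2) ltac:(nra)).
set (p := sqrt (1 + x ^ 2)) in *; set (q := sqrt (1 + v ^ 2)) in *.
assert (Hpq : x * v <= p * q).
{ apply Rsqr_incr_0_var; [unfold Rsqr | nra].
  replace (p * q * (p * q)) with (p ^ 2 * q ^ 2) by ring.
  rewrite Ea, Eb; nra. }
(* Multiply [v * p - x * q] by [p + q] and eliminate squares with [p ^ 2 = 1 + x ^ 2] and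
   [q ^ 2 = 1 + v ^ 2]; [Hpq] makes the remaining factor at least 1. *)
assert (E : v / q - x / p = (v - x) * (1 + p * q - x * v) / ((p + q) * (p * q))).
{ assert (E1 : 1 = p ^ 2 - x ^ 2) by lra.
  assert (E2 : q ^ 2 - p ^ 2 = v ^ 2 - x ^ 2) by lra.
  apply Rmult_eq_reg_r with ((p + q) * (p * q)); [ | nra].
  transitivity ((v * p - x * q) * (p + q)); [field; lra | ].
  transitivity ((v - x) * (1 + p * q - x * v)); [ | field; nra].
  transitivity ((v - x) * (p ^ 2 + p * q) - x * (q ^ 2 - p ^ 2)); [ring | ].
  rewrite E2; nra. }
assert (0 < (v - x) * (1 + p * q - x * v) / ((p + q) * (p * q))); [ | lra].
apply Rdiv_lt_0_compat; repeat apply Rmult_lt_0_compat; lra.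
Qed.

(** [v - u] times the trapezoidal sum of [A], minus twice the integral of [A];
    its derivative in the half-width, at fixed midpoint, is
    [2 r (T (m + r) - T (m - r))]. *)
Definition trapezoid_error (A AA : R -> R) (u v : R) : R :=
  (v - u) * (A u + A v) - 2 * (AA v - AA u).

(** Mean value theorem in the half-width, starting from the degenerate interval, where the error
    vanishes. The factor [k] carries the sign, so that both signs of the error are treated at
    once. *)
Lemma trapezoid_error_sign (T A AA : R -> R) (k u v : R) :
  (forall x, is_derive A x (T x)) -> (forall x, is_derive AA x (A x)) ->
  (forall r, 0 < r -> 0 < k * (T ((u + v) / 2 + r) - T ((u + v) / 2 - r))) ->
  u < v -> 0 < k * trapezoid_error A AA u v.
Proof.
intros HA HAA Hk Huv.
set (m := (u + v) / 2) in *.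
set (D := fun r => trapezoid_error A AA (m - r) (m + r)).
destruct (MVT_lt D (fun r => 2 * r * (T (m + r) - T (m - r))) 0 ((v - u) / 2))
  as [r [Hr E]]; [lra | | ].
{ intros r _; unfold D, trapezoid_error; auto_derive.
  - repeat split; eexists; auto.
  - rewrite_derivatives.
    ring_simplify; unfold Rminus; ring. }
replace (trapezoid_error A AA u v) with (D ((v - u) / 2)).
2: { unfold D; f_equal; unfold m; lra. }
assert (E0 : D 0 = 0).
{ unfold D, trapezoid_error; rewrite Rminus_0_r, Rplus_0_r; ring. }
replace (D ((v - u) / 2))
  with (r * (v - u) * (T (m + r) - T (m - r))) by lra.
replace (k * (r * (v - u) * (T (m + r) - T (m - r))))
  with (r * (v - u) * (k * (T (m + r) - T (m - r)))) by ring.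
apply Rmult_lt_0_compat; [apply Rmult_lt_0_compat; lra | apply Hk; lra].
Qed.

(** * Conserved quantities and uniqueness for the vertical system *)

Definition energy (lam : covector) : R :=
  c lam ^ 2 / 2 - alpha lam * sinh (theta lam).

(** The energy contains [c] only through its square, so it fixes [sinh theta] even when [c] changes
    sign, as it does at a would-be Maxwell point. *)
Lemma covector_eq (lam mu : covector) :
  alpha lam <> 0 -> alpha lam = alpha mu -> energy lam = energy mu ->
  c lam ^ 2 = c mu ^ 2 -> theta lam = theta mu.
Proof.
unfold energy; intros Ha Ea Ee Ec; apply sinh_inj.
rewrite <- Ea in Ee; apply Rmult_eq_reg_l with (alpha lam); lra.
Qed.

Lemma vertical_alpha (a b : R) (l : R -> covector) (s s' : R) :
  vertical_on a b l -> a < s < b -> a < s' < b -> alpha (l s) = alpha (l s').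
Proof.
intros Hl; apply (derive_zero_constant (fun u => alpha (l u))).
intros u Hu; apply Hl; auto.
Qed.

Lemma vertical_energy (a b : R) (l : R -> covector) (s s' : R) :
  vertical_on a b l -> a < s < b -> a < s' < b -> energy (l s) = energy (l s').
Proof.
intros Hl; apply (derive_zero_constant (fun u => energy (l u))).
intros u Hu; destruct (Hl u Hu) as [H1 [H2 H3]]; unfold energy.
(* [auto_derive] does not see a composite such as [theta (l v)] as a real function. *)
pose (th := fun v => theta (l v)); pose (cc := fun v => c (l v)).
pose (al := fun v => alpha (l v)).
change (is_derive (fun v => cc v ^ 2 / 2 - al v * sinh (th v)) u 0).
auto_derive.
- repeat split; eexists; eauto.
- rewrite_derivatives; unfold cc, al, th; field.
Qed.

Definition sinh_of_c (e al u : R) : R := (u ^ 2 / 2 - e) / al.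

Lemma sinh_theta (lam : covector) :
  alpha lam <> 0 ->
  sinh (theta lam) = sinh_of_c (energy lam) (alpha lam) (c lam).
Proof. intros Ha; unfold sinh_of_c, energy; field; auto. Qed.

Lemma vertical_sinh (a b : R) (l : R -> covector) (s : R) :
  vertical_on a b l -> a < 0 < b -> a < s < b -> alpha (l 0) <> 0 ->
  sinh (theta (l s)) = sinh_of_c (energy (l 0)) (alpha (l 0)) (c (l s)).
Proof.
intros Hl H0 Hs Ha.
rewrite <- (vertical_alpha a b l s 0 Hl Hs H0) in *.
rewrite <- (vertical_energy a b l s 0 Hl Hs H0).
apply sinh_theta; auto.
Qed.

(** With [cosh theta] expressed through [c] by the energy,
    [c' = - alpha cosh theta] is a separable equation for [c] alone. *)
Lemma vertical_unique (a b a' b' : R) (l l' : R -> covector) (t : R) :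
  vertical_on a b l -> vertical_on a' b' l' -> l 0 = l' 0 ->
  a < 0 < b -> a' < 0 < b' -> a < t < b -> a' < t < b' ->
  alpha (l 0) <> 0 -> l t = l' t.
Proof.
intros Hl Hl' E0 H0 H0' Ht Ht' Ha.
set (e := energy (l 0)); set (al := alpha (l 0)) in *.
set (S := fun u => sqrt (1 + sinh_of_c e al u ^ 2)).
assert (HS : forall u, 0 < S u) by (intros u; apply sqrt_lt_R0; nra).
destruct (antiderivative_exists (fun u => / S u)) as [P HP].
{ intros u; apply (ex_derive_comp (fun x => / sqrt (1 + x ^ 2)) (sinh_of_c e al)).
  - auto_derive; split; [nra | split; auto].
    apply Rgt_not_eq, sqrt_lt_R0; nra.
  - unfold sinh_of_c; auto_derive; auto. }
(* Separated form of the equation: [cosh theta = S c], so [P (c)] decreases at the constant rate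
   [al]. *)
assert (HPc : forall a b m, vertical_on a b m -> m 0 = l 0 ->
    a < 0 < b -> a < t < b -> P (c (m t)) + al * t = P (c (l 0))).
{ clear a b a' b' Hl Hl' H0 H0' Ht Ht'; intros a b m Hm Em H0 Ht.
  rewrite <- Em; transitivity (P (c (m 0)) + al * 0); [ | ring].
  apply (derive_zero_constant (fun s => P (c (m s)) + al * s) a b); auto.
  intros s Hs; destruct (Hm s Hs) as [_ [H2 _]].
  pose (cc := fun v => c (m v)).
  change (is_derive (fun v => P (cc v) + al * v) s 0).
  auto_derive.
  - repeat split; eexists; eauto.
  - rewrite_derivatives.
    unfold cc; rewrite (vertical_alpha a b m s 0), cosh_sinh, (vertical_sinh a b m s), Em; auto.
    + fold al e; fold (S (c (m s))); field; apply Rgt_not_eq, HS.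
    + rewrite Em; auto. }
assert (Ec : c (l t) = c (l' t)).
{ assert (HPlt : forall u v, u < v -> P u < P v).
  { intros u v Huv; destruct (MVT_lt P (fun u => / S u) u v Huv) as [s [_ Es]]; auto.
    assert (0 < / S s * (v - u)); [ | lra].
    apply Rmult_lt_0_compat; [apply Rinv_0_lt_compat, HS | lra]. }
  assert (H1 := HPc _ _ _ Hl eq_refl H0 Ht).
  assert (H2 := HPc _ _ _ Hl' (eq_sym E0) H0' Ht').
  destruct (Rtotal_order (c (l t)) (c (l' t))) as [L | [L | L]]; auto;
    apply HPlt in L; lra. }
assert (Ea : alpha (l t) = al) by (apply (vertical_alpha a b); auto).
assert (Ea' : alpha (l' t) = al).
{ unfold al; rewrite E0; apply (vertical_alpha a' b'); auto. }
assert (Eth : theta (l t) = theta (l' t)).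
{ apply covector_eq; try congruence.
  rewrite (vertical_energy a b l t 0), (vertical_energy a' b' l' t 0), E0; auto. }
destruct (l t), (l' t); simpl in *; congruence.
Qed.

(** * The sign of [y] along an extremal *)

Lemma extremal_y_sign (lam : covector) (a b : R)
    (l : R -> covector) (q : R -> point) (t : R) :
  extremal lam a b l q -> alpha lam <> 0 -> 0 < t < b ->
  c lam + c (l t) <> 0 -> 0 < y (q t) * (c lam + c (l t)).
Proof.
intros [H0 [<- [Eq0 [Hl Hq]]]] Ha Ht Hm.
set (e := energy (l 0)); set (al := alpha (l 0)) in *.
set (c0 := c (l 0)) in *.
set (T := fun u => tanh_of_sinh (sinh_of_c e al u)).
destruct (antiderivative_exists T) as [A HA].
{ intros u; apply (ex_derive_comp tanh_of_sinh (sinh_of_c e al)).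
  - unfold tanh_of_sinh; auto_derive; split; [nra | split; auto].
    apply Rgt_not_eq, sqrt_lt_R0; nra.
  - unfold sinh_of_c; auto_derive; auto. }
destruct (antiderivative_exists A) as [AA HAA].
{ intros u; eexists; apply HA. }
assert (Hc : forall s, a < s < b ->
    is_derive (fun u => c (l u)) s (- al * cosh (theta (l s)))).
{ intros s Hs; unfold al; rewrite (vertical_alpha a b l 0 s); auto; apply Hl; auto. }
(* Turns every velocity into a multiple of [cosh theta], hence of [c'], so that the coordinates
   integrate as functions of [c]. *)
assert (HT : forall s, a < s < b ->
    sinh (theta (l s)) = T (c (l s)) * cosh (theta (l s))).
{ intros s Hs; unfold T, tanh_of_sinh, e, al.
  rewrite <- (vertical_sinh a b), <- cosh_sinh; auto.
  field; apply Rgt_not_eq, cosh_pos. }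
assert (Hx1 : forall s, a < s < b -> al * x1 (q s) = c (l s) - c0).
{ intros s Hs.
  assert (E : al * x1 (q s) - c (l s) = al * x1 (q 0) - c (l 0)).
  { apply (derive_zero_constant (fun u => al * x1 (q u) - c (l u)) a b); auto.
    intros u Hu; destruct (Hq u Hu) as [H1 _].
    assert (H2 := Hc u Hu).
    pose (X := fun v => x1 (q v)); pose (cc := fun v => c (l v)).
    change (is_derive (fun v => al * X v - cc v) u 0).
    auto_derive.
    - repeat split; eexists; eauto.
    - rewrite_derivatives; ring. }
  rewrite Eq0 in E; simpl in E; unfold c0; lra. }
assert (Hx2 : forall s, a < s < b -> al * x2 (q s) = A c0 - A (c (l s))).
{ intros s Hs.
  assert (E : al * x2 (q s) + A (c (l s)) = al * x2 (q 0) + A (c (l 0))).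
  { apply (derive_zero_constant (fun u => al * x2 (q u) + A (c (l u))) a b); auto.
    intros u Hu; destruct (Hq u Hu) as [_ [H2 _]].
    assert (H1 := Hc u Hu); rewrite (HT u Hu) in H2.
    pose (X := fun v => x2 (q v)); pose (cc := fun v => c (l v)).
    change (is_derive (fun v => al * X v + A (cc v)) u 0).
    auto_derive.
    - repeat split; eexists; eauto.
    - rewrite_derivatives; unfold cc; ring. }
  rewrite Eq0 in E; simpl in E; unfold c0; lra. }
assert (Hy : 2 * al ^ 2 * y (q t) = - trapezoid_error A AA c0 (c (l t))).
{ assert (E : 2 * al ^ 2 * y (q t) + trapezoid_error A AA c0 (c (l t))
            = 2 * al ^ 2 * y (q 0) + trapezoid_error A AA c0 (c (l 0))).
  { unfold trapezoid_error.
    apply (derive_zero_constant (fun u => 2 * al ^ 2 * y (q u) +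
      ((c (l u) - c0) * (A c0 + A (c (l u))) - 2 * (AA (c (l u)) - AA c0))) a b);
      auto; [ | lra].
    intros u Hu; destruct (Hq u Hu) as [_ [_ [H3 _]]].
    assert (H2 := Hc u Hu); rewrite (HT u Hu) in H3.
    pose (Y := fun v => y (q v)); pose (cc := fun v => c (l v)).
    change (is_derive (fun v => 2 * al ^ 2 * Y v +
      ((cc v - c0) * (A c0 + A (cc v)) - 2 * (AA (cc v) - AA c0))) u 0).
    auto_derive.
    - repeat split; eexists; eauto.
    - rewrite_derivatives; unfold cc.
      (* Grouped so that [al * x1] and [al * x2] appear and their closed forms cancel the
         bracket. *)
      transitivity (al * (al * x2 (q u) + (al * x1 (q u)) * T (c (l u))
        - (A c0 + A (c (l u)) + (c (l u) - c0) * T (c (l u)) - 2 * A (c (l u))))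
        * cosh (theta (l u))); [field | ].
      rewrite (Hx1 u Hu), (Hx2 u Hu); ring. }
  rewrite Eq0 in E; unfold trapezoid_error, c0 in *; simpl y in E; lra. }
assert (Hcmon : exists d, 0 < d /\ c (l t) - c0 = - al * d).
{ destruct (MVT_lt (fun u => c (l u)) (fun s => - al * cosh (theta (l s))) 0 t)
    as [s [_ Es]]; [lra | intros s Hs; apply Hc; lra | ].
  exists (cosh (theta (l s)) * t); split.
  - apply Rmult_lt_0_compat; [apply cosh_pos | lra].
  - unfold c0; rewrite Es; ring. }
destruct Hcmon as [d [Hd Ed]].
set (c1 := c (l t)) in *.
(* [sinh_of_c] is quadratic and even up to a constant: its increment from [m - r] to [m + r] is
   [2 * m * r / al], and the increasing [tanh_of_sinh] keeps that sign. *)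
assert (HTk : forall m r, m <> 0 -> 0 < r -> 0 < (al * m) * (T (m + r) - T (m - r))).
{ intros m r Hm0 Hr.
  assert (Ediff : al * m * (sinh_of_c e al (m + r) - sinh_of_c e al (m - r))
                  = 2 * m ^ 2 * r) by (unfold sinh_of_c; field; auto).
  assert (Hpos : 0 < 2 * m ^ 2 * r).
  { apply Rmult_lt_0_compat; auto; generalize (pow2_gt_0 m Hm0); lra. }
  unfold T.
  destruct (Rtotal_order (sinh_of_c e al (m - r)) (sinh_of_c e al (m + r)))
    as [L | [L | L]].
  - assert (L' := tanh_of_sinh_lt _ _ L); nra.
  - rewrite L in Ediff; lra.
  - assert (L' := tanh_of_sinh_lt _ _ L); nra. }
assert (Hal2 : 0 < 2 * al ^ 2) by (generalize (pow2_gt_0 al Ha); lra).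
assert (Hsgn : forall u v, u < v -> u + v = c0 + c1 ->
    0 < al * ((c0 + c1) / 2) * trapezoid_error A AA u v).
{ intros u v Huv Es; apply (trapezoid_error_sign T); auto.
  intros r Hr; rewrite Es; apply HTk; lra. }
apply Rmult_lt_reg_l with (2 * al ^ 2); [auto | ].
rewrite Rmult_0_r, <- Rmult_assoc, Hy.
(* [c] increases if [al < 0] and decreases if [al > 0]; in the latter case the endpoints are
   swapped, which negates the error. *)
destruct (Rtotal_order al 0) as [L | [L | L]]; [ | lra | ].
- assert (H := Hsgn c0 c1 ltac:(nra) ltac:(ring)); nra.
- assert (H := Hsgn c1 c0 ltac:(nra) ltac:(ring)).
  replace (trapezoid_error A AA c0 c1) with (- trapezoid_error A AA c1 c0)
    by (unfold trapezoid_error; ring).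
  nra.
Qed.

(** * Time reversal and the values of [Exp] and [flow_v] *)

Lemma extremal_reverse (lam : covector) (a b : R)
    (l : R -> covector) (q : R -> point) (t : R) :
  extremal lam a b l q -> a < t < b ->
  exists q', extremal (Defs.eps2 (l t)) (t - b) (t - a) (fun s => Defs.eps2 (l (t - s))) q'.
Proof.
intros [H0 [_ [_ [Hl Hq]]]] Ht.
set (X1 := x1 (q t)); set (X2 := x2 (q t)).
(* Along [q], [f] and [g] are primitives of minus the right sides for [y] and [z] with [x1], [x2]
   replaced by [X1 - x1], [X2 - x2]; reversing time restores the sign. *)
set (f := fun p => / 2 * (X2 * x1 p - X1 * x2 p) + y p).
(* [y + x1 x2 / 2] is a primitive of [x1 x2']. *)
set (g := fun p => - / 2 * (X1 ^ 2 + X2 ^ 2) * x2 p + / 2 * X2 * x2 p ^ 2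
                   + X1 * (y p + / 2 * (x1 p * x2 p)) - z p).
exists (fun s => Point (X1 - x1 (q (t - s))) (X2 - x2 (q (t - s)))
                 (f (q (t - s)) - f (q t)) (g (q (t - s)) - g (q t))).
split; [lra | split; [now rewrite Rminus_0_r | split; [ | split]]].
- unfold origin; rewrite Rminus_0_r; fold X1 X2; f_equal; ring.
- intros s Hs; destruct (Hl (t - s)) as [H1 [H2 H3]]; [lra | ].
  pose (th := fun v => theta (l v)); pose (cc := fun v => c (l v)).
  pose (al := fun v => alpha (l v)).
  split; [ | split].
  + change (is_derive (fun v => th (t - v)) s (- - cc (t - s))).
    auto_derive; [eexists; eauto | rewrite_derivatives; unfold cc; ring].
  + change (is_derive (fun v => - cc (t - v)) s (- al (t - s) * cosh (th (t - s)))).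
    auto_derive; [eexists; eauto | rewrite_derivatives; unfold al, th; ring].
  + change (is_derive (fun v => al (t - v)) s 0).
    auto_derive; [eexists; eauto | rewrite_derivatives; ring].
- intros s Hs; destruct (Hq (t - s)) as [H1 [H2 [H3 H4]]]; [lra | ].
  simpl x1; simpl x2; simpl y; simpl z; simpl theta.
  pose (u1 := fun v => x1 (q v)); pose (u2 := fun v => x2 (q v)).
  pose (u3 := fun v => y (q v)); pose (u4 := fun v => z (q v)).
  split; [ | split; [ | split]].
  + change (is_derive (fun v => X1 - u1 (t - v)) s (- cosh (theta (l (t - s))))).
    auto_derive; [eexists; eauto | rewrite_derivatives; ring].
  + change (is_derive (fun v => X2 - u2 (t - v)) s (sinh (theta (l (t - s))))).
    auto_derive; [eexists; eauto | rewrite_derivatives; ring].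
  + match goal with |- is_derive _ _ ?d => change (is_derive (fun v =>
      / 2 * (X2 * u1 (t - v) - X1 * u2 (t - v)) + u3 (t - v) - f (q t)) s d) end.
    auto_derive; [repeat split; eexists; eauto | rewrite_derivatives; field].
  + match goal with |- is_derive _ _ ?d => change (is_derive (fun v =>
      - / 2 * (X1 ^ 2 + X2 ^ 2) * u2 (t - v) + / 2 * X2 * u2 (t - v) ^ 2
      + X1 * (u3 (t - v) + / 2 * (u1 (t - v) * u2 (t - v))) - u4 (t - v) - g (q t)) s d) end.
    auto_derive; [repeat split; eexists; eauto | rewrite_derivatives].
    unfold u1, u2; fold (t - s); field.
Qed.

(** If no solution passed [t], then [t] would bound all the right ends and hence their supremum. *)
Lemma N_extremal (lam : covector) (t : R) :
  Defs.N lam t -> exists a b l q, extremal lam a b l q /\ a < t < b.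
Proof.
intros [Ht Hsup]; apply NNPP; intros Hno.
unfold t_supr in Hsup.
destruct (Lub_Rbar_correct (fun b => exists a l q, extremal lam a b l q)) as [_ Hleast].
apply (Rbar_lt_not_le _ _ Hsup), Hleast.
intros b [a [l [q He]]]; simpl.
apply Rnot_lt_le; intros Hb; apply Hno; exists a, b, l, q; split; auto.
destruct He as [H0 _]; lra.
Qed.

(** The extremal obtained may differ from the given one; [extremal_y_sign] holds for every extremal,
    so any choice serves. *)
Lemma Exp_spec (lam : covector) (t : R) :
  (exists a b l q, extremal lam a b l q /\ a < t < b) ->
  exists a b l q, extremal lam a b l q /\ a < t < b /\ q t = Exp lam t.
Proof.
intros [a [b [l [q [He Ht]]]]]; unfold Exp; apply epsilon_spec.
exists (q t), a, b, l, q; auto.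
Qed.

Lemma flow_v_extremal (lam : covector) (a b : R)
    (l : R -> covector) (q : R -> point) (t : R) :
  extremal lam a b l q -> a < t < b -> alpha lam <> 0 -> flow_v t lam = l t.
Proof.
intros [H0 [E0 [_ [Hl _]]]] Ht Ha.
assert (Hsp : exists a b l, a < 0 < b /\ l 0 = lam /\ vertical_on a b l /\
                  a < t < b /\ l t = flow_v t lam).
{ unfold flow_v; apply epsilon_spec; exists (l t), a, b, l; auto. }
destruct Hsp as [a' [b' [l' [H0' [E0' [Hl' [Ht' <-]]]]]]].
apply (vertical_unique a' b' a b); auto; congruence.
Qed.

Lemma MAX2_alpha (lam : covector) (t : R) : MAX2 lam t -> alpha lam = 0.
Proof.
intros [HN [Hne HE]]; apply NNPP; intros Ha.
assert (Ht0 : 0 < t) by apply HN.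
destruct (Exp_spec lam t (N_extremal lam t HN)) as [a [b [l [q [He [Ht Eq]]]]]].
assert (El : lambda2 lam t = Defs.eps2 (l t)).
{ unfold lambda2; f_equal; apply (flow_v_extremal lam a b l q); auto. }
rewrite El in Hne, HE; clear El.
assert (Hv := He); destruct Hv as [H0 [E0 [_ [Hl _]]]].
assert (Ea : alpha (l t) = alpha lam).
{ rewrite <- E0; apply (vertical_alpha a b); auto. }
(* The case of sum zero makes the reflected covector equal to [lam]. *)
destruct (Req_dec (c lam + c (l t)) 0) as [Hm | Hm].
{ apply Hne.
  assert (Eth : theta (l t) = theta lam).
  { apply covector_eq; [congruence | auto | | ].
    - rewrite <- E0; apply (vertical_energy a b); auto.
    - replace (c lam) with (- c (l t)) by lra; ring. }
  unfold Defs.eps2; rewrite Eth, Ea.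
  replace (- c (l t)) with (c lam) by lra.
  destruct lam; reflexivity. }
assert (Hy := extremal_y_sign lam a b l q t He Ha ltac:(lra) Hm).
destruct (extremal_reverse lam a b l q t He Ht) as [qr Hr].
destruct (Exp_spec (Defs.eps2 (l t)) t) as [a2 [b2 [l2 [q2 [He2 [Ht2 Eq2]]]]]].
{ exists (t - b), (t - a), (fun s => Defs.eps2 (l (t - s))), qr; split; auto; lra. }
assert (Ha2 : alpha (Defs.eps2 (l t)) <> 0) by (simpl; congruence).
(* [l2] and the reversed curve start at the same covector, so both end at [eps2 (l 0)]. *)
assert (Ec2 : c (l2 t) = - c lam).
{ rewrite <- (flow_v_extremal _ _ _ _ _ t He2 Ht2 Ha2).
  rewrite (flow_v_extremal _ _ _ _ _ t Hr ltac:(lra) Ha2).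
  simpl; rewrite Rminus_diag, E0; reflexivity. }
assert (Hy2 := extremal_y_sign _ a2 b2 l2 q2 t He2 Ha2 ltac:(lra)).
rewrite Ec2, Eq2, HE, <- Eq in Hy2; simpl in Hy2.
(* The common value of [y] would have a positive product with both [c lam + c (l t)] and its
   opposite. *)
assert (H := Hy2 ltac:(lra)).
replace (- c (l t) + - c lam) with (- (c lam + c (l t))) in H by ring.
rewrite Ropp_mult_distr_r_reverse in H; lra.
Qed.

Theorem theorem5 :
  (forall (lam : covector) (t : R), ~ (MAX2 lam t /\ Nplus lam t)) /\
  (forall (lam : covector) (t : R), ~ (MAX2 lam t /\ Nminus lam t)).
Proof.
split; intros lam t [HM [_ Hs]]; apply MAX2_alpha in HM;
  unfold Defs.Cplus, Defs.Cminus in Hs; lra.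
Qed.
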